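(* Let $G$ be a finite solvable group, let $l$ be the length of the derived series of $G$, and let $n\ge 1$ be an integer. Then $$D^s(G^n) \le 4^{l-1}\, n^l\, |G|.$$
   Context: For a finite group $G$ with generating set $A$ and $g\in G$, the symmetric length $l^s_A(g)$ is the minimum length of a word in the elements of $A\cup A^{-1}$ representing $g$ (the identity is represented by the empty word, of length $0$), where $A^{-1}=\{a^{-1}:a\in A\}$. The symmetric diameter is $\operatorname{diam}^s(G,A)=\max\{l^s_A(g): g\in G\}$, and $D^s(G)$ is the maximum of $\operatorname{diam}^s(G,A)$ over all generating sets $A$ of $G$. $G^n$ is the $n$-th direct power of $G$. The length of the derived series is the least $l$ with $G^{(l)}=\{1\}$, where $G^{(0)}=G$ and $G^{(i+1)}$ is the commutator subgroup of $G^{(i)}$. *)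

(* Defs.v *)
From HB Require Import structures.
From mathcomp Require Import all_boot all_order all_algebra all_fingroup all_solvable.

Set Implicit Arguments.
Unset Strict Implicit.
Unset Printing Implicit Defensive.

Import GroupScope.

Section SymmetricLength.

Variable gT : finGroupType.
Implicit Types (A G : {set gT}) (g : gT).

(* In group_scope, A^-1 is the set of the inverses of the elements of A. *)
Definition sym_word A g (k : nat) : bool :=
  [exists w : k.-tuple gT,
    all [in A :|: A^-1] w && (\prod_(x <- w) x == g)].

Lemma sym_word_ex A g : g \in <<A>> -> exists k, sym_word A g k.
Proof.
case/gen_prodgP=> k [c cA ->]; exists k; apply/existsP.
exists [tuple c i | i < k]; apply/andP; split.
  by apply/all_tnthP=> i; rewrite tnth_mktuple inE cA.
by rewrite big_tuple; apply/eqP/eq_bigr=> i _; rewrite tnth_mktuple.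
Qed.

(* Only meaningful when g lies in <<A>>; the value 0 elsewhere is junk. *)
Definition sym_length A g : nat :=
  match @idP (g \in <<A>>) with
  | ReflectT gA => ex_minn (sym_word_ex gA)
  | ReflectF _ => 0
  end.

Definition sym_diam G A : nat := \max_(g in G) sym_length A g.

Definition max_sym_diam G : nat :=
  \max_(A : {set gT} | <<A>> == G) sym_diam G A.

Definition derived_length_is G (l : nat) : Prop :=
  G^`(l) = 1 /\ forall m : nat, G^`(m) = 1 -> l <= m.

Lemma sym_lengthP A g : g \in <<A>> ->
  sym_word A g (sym_length A g) /\
  forall k, sym_word A g k -> sym_length A g <= k.
Proof.
by rewrite /sym_length => gA; case: {-}_ / idP => // gA'; case: ex_minnP.
Qed.

End SymmetricLength.

Definition dpower (gT : finGroupType) (G : {group gT}) (n : nat) :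
    {group {dffun 'I_n -> gT}} :=
  [group of setXn (fun _ : 'I_n => G)].

(* Main.v *)
(* Induction on the derived length.  With G' the commutator subgroup, the
   abelian quotient G^n / G'^n has diameter at most d = n |G : G'|: adjoining the
   generators one at a time gives a chain of subgroups of indices
   m_i <= M = |G : G'| with product M^n, every element is a product of powers
   of the generators with exponents < m_i, and the sum of the m_i - 1 is at most
   n (M - 1) because m - 1 <= (M - 1) log_M m for 1 <= m <= M (concavity).
   Schreier's lemma generates G'^n by words of length at most 2 d + 1, hence
   D(G^n) <= d + (2 d + 1) k <= 4 d k for every bound k >= 1 of D(G'^n). *)
Require Import Defs.
From HB Require Import structures.
From mathcomp Require Import all_boot all_order all_algebra all_fingroup all_solvable.
From mathcomp Require Import zify.

Import Order.TTheory GRing.Theory Num.Theory.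
Local Open Scope ring_scope.

(** * Integer inequalities replacing logarithms *)

Section PowerInequalities.
Local Open Scope nat_scope.

(** The Bernoulli-type bound [(1 + 1/m)^j <= m / (m - j)], with [j] free for the induction; it is
    applied at [j = m - 1], as [(m + 1)^(m - 1) <= m^m]. *)
Lemma expn_succ_bernoulli m j : j <= m -> (m - j) * m.+1 ^ j <= m ^ j.+1.
Proof.
elim: j => [|j IH] jm; first by rewrite subn0 expn0 muln1 expn1.
have le1 : (m - j.+1) * m.+1 <= m * (m - j) by nia.
rewrite expnS mulnA (leq_trans (leq_mul le1 (leqnn _))) // -mulnA.
by rewrite [m ^ j.+2]expnS leq_mul2l IH ?orbT // ltnW.
Qed.

(* That is, m - 1 <= (M - 1) log_M m for m = k + 1 <= M. *)
Lemma expn_pred_leq M k : k < M -> M ^ k <= k.+1 ^ M.-1.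
Proof.
(* Descending induction on [k] from [M - 1], where both sides are equal. *)
move=> ltkM; have [j ->] : exists j, k = M.-1 - j by exists (M.-1 - k); lia.
elim: j => [|j IH]; first by rewrite subn0 prednK //; lia.
case: (posnP (M.-1 - j)) => [E|pos].
  by rewrite (_ : M.-1 - j.+1 = 0) ?expn0 ?exp1n //; lia.
move: IH; have [i -> ->] : exists2 i, M.-1 - j = i.+1 & M.-1 - j.+1 = i.
  by exists (M.-1 - j.+1); lia.
(* After raising to the power [i + 1], the chain is [M^((i+1)i) <= (i+2)^((M-1)i) <=
   (i+1)^((i+1)(M-1))]. *)
move=> IH; rewrite -(leq_exp2r _ _ (ltn0Sn i)) -expnM mulnC expnM.
have le1 : (M ^ i.+1) ^ i <= (i.+2 ^ M.-1) ^ i.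
  by case: (i) IH => [|i'] IH; rewrite ?expn0 // leq_exp2r.
apply: leq_trans le1 _.
rewrite -!expnM mulnC [_.-1 * i.+1]mulnC !expnM.
case: (posnP M.-1) => [->|M1]; first by rewrite !expn0.
rewrite leq_exp2r //.
by have := expn_succ_bernoulli i.+1 i (leqnSn i); rewrite subSnn mul1n.
Qed.

End PowerInequalities.

(** * Balls in Cayley graphs, group extensions and abelian groups *)

Section Balls.
Set Implicit Arguments.
Unset Strict Implicit.
Local Open Scope nat_scope.
Local Open Scope group_scope.
Variable gT : finGroupType.
Implicit Types (A B : {set gT}) (G H N Q : {group gT}).

(** Including 1 makes the [k]-th power the ball of all words of length at most [k], so balls
    increase with [k]. *)
Definition symset A : {set gT} := 1 :|: A :|: A^-1.

Definition diam_le (X : {set gT}) d :=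
  forall A, <<A>> = X -> X \subset symset A ^+ d.

Lemma symset1 A : 1 \in symset A. Proof. by rewrite !inE eqxx. Qed.

Lemma symsetV A : (symset A)^-1 = symset A.
Proof. by rewrite /symset !invUg invgK invg1 -setUA [_^-1 :|: A]setUC setUA. Qed.

Lemma sub_symset A : A \subset symset A.
Proof. by apply/subsetP => x Ax; rewrite !inE Ax orbT. Qed.

Lemma symset_sub_gen A : symset A \subset <<A>>.
Proof. by rewrite !subUset sub1G subset_gen -invSg invgK invGid subset_gen. Qed.

Lemma expsgS A B k : A \subset B -> A ^+ k \subset B ^+ k.
Proof.
by move=> sAB; elim: k => [|k IH]; rewrite ?expg0 // !expgS mulgSS.
Qed.

Lemma expsg_sub_group A G k : A \subset G -> A ^+ k \subset G.
Proof.
move=> sAG; elim: k => [|k IH]; rewrite ?sub1G // expgS.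
by rewrite -(mulGid G) mulgSS.
Qed.

Lemma ball_leq A i j : i <= j -> symset A ^+ i \subset symset A ^+ j.
Proof.
move=> /subnKC <-; elim: (j - i)%N => [|k IH]; first by rewrite addn0.
by rewrite addnS expgS (subset_trans IH) // mulg_subr ?symset1.
Qed.

Lemma ball1 A k : 1 \in symset A ^+ k.
Proof. by rewrite (subsetP (ball_leq _ (leq0n k))) // expg0 set11. Qed.

Lemma ballV A k x : x \in symset A ^+ k -> x^-1 \in symset A ^+ k.
Proof.
elim: k x => [|k IH] x; first by rewrite !expg0 => /set1P->; rewrite invg1 set11.
rewrite expgS => /mulsgP[a b Sa /IH Sb ->].
by rewrite -expgS expgSr invMg mem_mulg // -mem_invg symsetV.
Qed.

Lemma ball_pow A x k i : x \in symset A -> i <= k -> x ^+ i \in symset A ^+ k.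
Proof.
move=> Sx /(@ball_leq A) /subsetP; apply.
by elim: i => [|i IH]; rewrite ?expg0 ?set11 // !expgS mem_mulg.
Qed.

Lemma gen_left_closed A (X : {set gT}) :
  1 \in X -> (forall a x, a \in A -> x \in X -> a * x \in X) -> <<A>> \subset X.
Proof.
move=> X1 XA; apply/subsetP => _ /gen_prodgP[k [c cA ->]].
elim: k c cA => [|k IH] c cA; rewrite ?big_ord0 // big_ord_recl.
by apply: (XA) (cA _) _; apply: IH.
Qed.

(* The Schreier generators s'^-1 a s of N have length at most 2d + 1. *)
Lemma diam_le_ext A H N d k : <<A>> = H -> N \subset H ->
  H \subset symset A ^+ d * N -> diam_le N k ->
  H \subset symset A ^+ (d + d.*2.+1 * k)%N.
Proof.
move=> genA sNH sHSN dN; pose T := N :&: symset A ^+ d.*2.+1.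
have sAH : A \subset H by rewrite -genA subset_gen.
have sSH i : symset A ^+ i \subset H.
  by rewrite expsg_sub_group // -genA symset_sub_gen.
have sTN : <<T>> \subset N by rewrite gen_subG subsetIl.
(* The right side contains 1 and is stable under left multiplication by [A]: if [a * s = s' * n],
   then [n = s'^-1 * a * s] lies in [T]. *)
have sHX : H \subset symset A ^+ d * <<T>>.
  rewrite -genA; apply: gen_left_closed => [|a _ Aa /mulsgP[s t Ss Tt ->]].
    by rewrite -(mulg1 1) mem_mulg ?group1 ?ball1.
  have : a * s \in H by rewrite groupM ?(subsetP sAH a) ?(subsetP (sSH d) s).
  case/(subsetP sHSN)/mulsgP => s' n Ss' Nn def.
  rewrite mulgA def -mulgA mem_mulg // groupM // mem_gen // inE Nn.
  rewrite -(mulKg s' n) -def -addnn -addnS expgD mem_mulg ?ballV //.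
  by rewrite expgS mem_mulg // (subsetP (sub_symset A)).
have genT : <<T>> = N.
  (* Write [x = s * t] as above; then [s = x * t^-1] is in [N] and in the ball of radius [d], hence
     in [T]. *)
  apply/eqP; rewrite eqEsubset sTN; apply/subsetP => x Nx.
  have /mulsgP[s t Ss Tt def] := subsetP sHX _ (subsetP sNH _ Nx).
  rewrite def groupM // mem_gen // inE -(mulgK t s) -def groupM //=; last first.
    by rewrite groupV (subsetP sTN).
  by rewrite def mulgK (subsetP (ball_leq _ _) _ Ss) // -addnn -addnS leq_addr.
apply: subset_trans sHSN _; rewrite expgD mulgS // expgM.
apply: subset_trans (dN T genT) (expsgS _ _).
rewrite !subUset sub1set ball1 subsetIr /= -invSg invgK.
by apply/subsetP => x; rewrite !inE => /andP[_ /ballV].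
Qed.

Lemma abelian_diam Q M n : 0 < M -> abelian Q ->
  (forall x, x \in Q -> x ^+ M = 1) -> #|Q| <= (M ^ n)%N -> diam_le Q (n * M)%N.
Proof.
move=> M0 abQ expM cardQ A genA.
have sAQ : A \subset Q by rewrite -genA subset_gen.
(* The second condition is the logarithm-free form of [k <= (M - 1) log_M |<s>|]; for the whole of
   [Q] it yields [k <= n (M - 1)]. *)
suff chain s : {subset s <= A} -> exists2 k,
    <<[set:: s]>> \subset symset A ^+ k & (M ^ k <= #|<<[set:: s]>>| ^ M.-1)%N.
  have [|k] := chain (enum A) => [x|]; first by rewrite mem_enum.
  have -> : [set:: enum A] = A by apply/setP => x; rewrite inE mem_enum.
  rewrite genA => sQk lek.
  (* Exponents of [M] can be compared only if [M > 1]; for [M = 1] the group is trivial. *)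
  case: (ltnP 1 M) => [M1|M1]; last first.
    have M1' : M = 1%N by lia.
    apply: subset_trans (ball_leq _ (leq0n _)).
    by apply/subsetP => x /expM; rewrite M1' expg1 => ->; rewrite expg0 set11.
  apply: subset_trans sQk (ball_leq _ _).
  have : (M ^ k <= (M ^ n) ^ M.-1)%N.
    by rewrite (leq_trans lek) // leq_exp2r //; lia.
  by rewrite -expnM leq_exp2l // => /leq_trans-> //; rewrite leq_mul2l leq_pred orbT.
elim: s => [|a s IH] sA.
  exists 0%N => //; rewrite ?expg0 ?expn0; last by rewrite expn_gt0 cardG_gt0.
  by rewrite gen_subG; apply/subsetP => x; rewrite inE.
case: IH => [x xs|k]; first by rewrite sA // inE xs orbT.
pose K := <<[set:: s]>>%G; rewrite -[<<_>>]/(gval K) => sKk lek.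
have Aa : a \in A by rewrite sA ?mem_head.
have Qa := subsetP sAQ a Aa.
have sKQ : K \subset Q.
  rewrite gen_subG; apply/subsetP => x; rewrite inE => xs.
  by rewrite (subsetP sAQ) // sA // inE xs orbT.
have nKQ : Q \subset 'N(K) by rewrite (sub_abelian_norm abQ).
have sCQ : <[a]> \subset Q by rewrite cycle_subG.
have nKa : <[a]> \subset 'N(K) := subset_trans sCQ nKQ.
have defKa : <<[set:: a :: s]>> = <[a]> * K.
  rewrite -norm_joinEl // joingC /K /= joing_idl joing_idr.
  by congr << _ >>; apply/setP => x; rewrite !inE orbC.
set m := #[coset K a].
have mM : m <= M.
  rewrite dvdn_leq // order_dvdn -morphX ?(subsetP nKQ) // expM // morph1 //.
have cardKa : #|<[a]> * K| = (m * #|K|)%N.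
  rewrite -norm_joinEl // -(Lagrange (joing_subr _ _)) mulnC; congr (_ * _)%N.
  rewrite -card_quotient /= ?join_subG ?nKa ?normG // quotientYidr //.
  by rewrite quotient_cycle ?(subsetP nKQ).
have m0 : 0 < m by rewrite order_gt0.
(* An element of [<[a]> * K] is [a ^+ i] with [i < m] times an element of [K]. The size condition is
   multiplicative, the new factor being [M^(m-1) <= m^(M-1)]. *)
exists (m.-1 + k)%N; rewrite defKa; last first.
  rewrite cardKa expnMn expnD leq_mul //.
  by have := expn_pred_leq M m.-1; rewrite prednK //; apply.
apply/subsetP => x xKa.
have nKx : x \in 'N(K).
  by apply: subsetP xKa; rewrite mul_subG ?normG.
have : coset K x \in <[coset K a]>.
  rewrite -quotient_cycle ?(subsetP nKQ) // -quotientMidr.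
  exact: mem_morphim.
case/cyclePmin => i ltim; rewrite -morphX ?(subsetP nKQ) // => eqx.
have nKai : a ^+ i \in 'N(K) by rewrite groupX ?(subsetP nKQ).
have : (a ^+ i)^-1 * x \in K.
  apply: coset_idr; first by rewrite groupM ?groupV.
  by rewrite morphM ?groupV //= morphV //= eqx mulVg.
move/(subsetP sKk) => Sx; rewrite -(mulKVg (a ^+ i) x) expgD mem_mulg //.
by rewrite ball_pow ?(subsetP (sub_symset A)) // -ltnS prednK.
Qed.

End Balls.

(** * Direct powers and induction along the derived series *)

Section Powers.
Set Implicit Arguments.
Unset Strict Implicit.
Local Open Scope nat_scope.
Local Open Scope group_scope.
Variable n : nat.
Implicit Types gT : finGroupType.

Lemma symset_morphim (gT rT : finGroupType) (D : {group gT})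
    (f : {morphism D >-> rT}) (A : {set gT}) k :
  A \subset D -> f @* (symset A ^+ k) = symset (f @* A) ^+ k.
Proof.
move=> sAD; have sSD : symset A \subset D.
  by rewrite (subset_trans (symset_sub_gen A)) // gen_subG.
elim: k => [|k IH]; first by rewrite !expg0 morphim1.
rewrite !expgS morphimMl // IH /symset.
by rewrite !morphimU morphim1 -morphimV.
Qed.

Lemma dffun_expgE gT (x : {dffun 'I_n -> gT}) k i : (x ^+ k) i = x i ^+ k.
Proof. by elim: k => [|k IH]; rewrite ?expg0 ?expgS ffunE // IH. Qed.

Lemma dpower1_diam gT (G : {group gT}) : G :=: 1 -> diam_le (dpower G n) 0.
Proof.
move=> G1 A _; apply/subsetP => x /setXnP Gx; rewrite expg0; apply/set1P.
by apply/ffunP => i; rewrite ffunE; apply/set1P; rewrite -set1gE -G1.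
Qed.

Lemma dpower_diam_step gT (G : {group gT}) k :
  diam_le (dpower G^`(1) n) k ->
  let d := (n * #|G : G^`(1)|)%N in
  diam_le (dpower G n) (d + d.*2.+1 * k)%N.
Proof.
move=> dk d A genA; set N := dpower G^`(1) n in dk.
have sNH : N \subset dpower G n by apply: setXnS => i; apply: der_sub.
have nNH : dpower G n \subset 'N(N).
  apply/subsetP => x /setXnP Gx; rewrite inE; apply/subsetP => _ /imsetP[y Ny ->].
  move/setXnP: Ny => Ny; apply/setXnP => i; rewrite !ffunE.
  by rewrite -conjgE memJ_norm // (subsetP (der_norm 1 G)).
have abQ : abelian (dpower G n / N).
  apply: sub_der1_abelian; rewrite gen_subG; apply/subsetP=> z.
  case/imset2P=> x y /setXnP Gx /setXnP Gy ->; apply/setXnP => i.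
  by rewrite commgEl conjgE !ffunE -conjgE -commgEl mem_commg.
have expM x : x \in dpower G n / N -> x ^+ #|G : G^`(1)| = 1.
  case/morphimP => y nNy /setXnP Gy ->; rewrite -morphX //.
  apply: coset_id; apply/setXnP => i; rewrite dffun_expgE.
  apply: coset_idr; first by rewrite groupX ?(subsetP (der_norm 1 G)).
  rewrite morphX ?(subsetP (der_norm 1 G)) // -card_quotient ?der_norm //.
  by rewrite expg_cardG // mem_quotient.
have cardQ : #|dpower G n / N| = (#|G : G^`(1)| ^ n)%N.
  rewrite card_quotient //; apply/eqP; rewrite -(eqn_pmul2l (cardG_gt0 N)).
  rewrite Lagrange // !cardsXn !prod_nat_const card_ord -expnMn.
  by rewrite Lagrange ?der_sub.
have dQ : diam_le (dpower G n / N) d.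
  by apply: abelian_diam abQ expM _; rewrite ?cardQ ?indexg_gt0.
apply: (diam_le_ext genA sNH _ dk).
have sSH : symset A ^+ d \subset dpower G n.
  by rewrite expsg_sub_group // -genA symset_sub_gen.
have sAN : A \subset 'N(N) by rewrite (subset_trans _ nNH) // -genA subset_gen.
(* The ball of radius [d] meets every coset of [N] because its image is the ball of the image of [A]
   in the quotient. *)
rewrite (normC (subset_trans sSH nNH)) -quotientSK //.
rewrite /quotient symset_morphim //; apply: dQ.
by rewrite -morphim_gen // genA.
Qed.

Lemma der_der1 gT (G : {group gT}) l : G^`(1)^`(l) = G^`(l.+1).
Proof. by elim: l => [|l IH] //; rewrite dergSn IH. Qed.

Lemma dpower_diam gT (G : {group gT}) l : 0 < n -> G^`(l.+1) = 1 ->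
  diam_le (dpower G n) (4 ^ l * n ^ l.+1 * #|G|)%N.
Proof.
move=> n0; elim: l G => [|l IH] G Gl.
  (* Here [G] is abelian: the extension step over a trivial subgroup, with [k = 0], leaves only
     [d = n * #|G|]. *)
  have dN : diam_le (dpower G^`(1) n) 0 by apply: dpower1_diam.
  have := dpower_diam_step dN; rewrite /= muln0 addn0 Gl indexg1.
  by rewrite expn0 expn1 mul1n.
have := IH [group of G^`(1)] (etrans (der_der1 _ _) Gl).
move/dpower_diam_step => /= step A /step /subset_trans; apply; apply: ball_leq.
rewrite -(Lagrange (der_sub 1 G)).
set a := #|G : _|; set b := #|G^`(1)|.
have a0 : 0 < a by apply: indexg_gt0.
have b0 : 0 < b by apply: cardG_gt0.
have X0 : 0 < (4 ^ l * n ^ l.+1 * b)%N by rewrite !muln_gt0 !expn_gt0 n0.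
have d0 : 0 < (n * a)%N by rewrite muln_gt0 n0.
have -> : (4 ^ l.+1 * n ^ l.+2 * (b * a) =
           4 * (n * a) * (4 ^ l * n ^ l.+1 * b))%N.
  by rewrite (expnS 4) (expnS n l.+1); lia.
move: (4 ^ l * n ^ l.+1 * b)%N X0 (n * a)%N d0 => X X0 d d0.
(* Since [d] and [X] are positive, [d] and [X] are each at most [d * X], so
   [d + (2 d + 1) X <= 4 d X]. *)
by nia.
Qed.

End Powers.

(** * From balls back to symmetric word length *)

Lemma max_sym_diam_leq (gT : finGroupType) (X : {set gT}) d :
  diam_le X d -> (max_sym_diam X <= d)%N.
Proof.
move=> dX; apply/bigmax_leqP => A /eqP genA; apply/bigmax_leqP => g Xg.
have Ag : g \in <<A>>%g by rewrite genA.
have [_ minA] := sym_lengthP Ag.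
suff [k ltkd wk] : exists2 k, (k <= d)%N & sym_word A g k.
  exact: leq_trans (minA _ wk) ltkd.
move/(subsetP (dX A genA)): Xg; clear.
elim: d g => [|d IH] g.
  rewrite expg0 => /set1P ->; exists 0%N => //.
  by apply/existsP; exists [tuple]; rewrite /= big_nil eqxx.
rewrite expgS => /mulsgP[x h Sx /IH[k lekd /existsP[w /andP[Aw /eqP <-]]] ->].
(* A factor 1 is dropped from the word, which is why the length is only bounded by the radius. *)
case/setUP: (Sx) => [/setUP[/set1P ->|Ax]|Ax].
- exists k; first exact: leqW.
  by apply/existsP; exists w; rewrite Aw mul1g eqxx.
- exists k.+1 => //; apply/existsP; exists [tuple of x :: w].
  by rewrite /= big_cons eqxx Aw inE Ax.
- exists k.+1 => //; apply/existsP; exists [tuple of x :: w].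
  by rewrite /= big_cons eqxx Aw inE Ax orbT.
Qed.

Theorem proposition5p20 (gT : finGroupType) (G : {group gT}) (l n : nat)
    (solG : solvable G) (lG : derived_length_is G l) (n_ge1 : (1 <= n)%N) :
  (max_sym_diam (dpower G n))%:R <=
    4 ^ (l%:Z - 1) * n%:R ^+ l * #|G|%:R :> rat.
Proof.
case: lG => Gl _; case: l Gl => [|l] Gl.
  (* For [l = 0] the power is trivial with diameter 0, and the right side, where 4 has exponent -1,
     is nonnegative. *)
  have/max_sym_diam_leq := dpower1_diam (n := n) Gl.
  by rewrite leqn0 => /eqP ->; rewrite !mulr_ge0 ?exprz_ge0 ?exprn_ge0.
have /max_sym_diam_leq le := dpower_diam n_ge1 Gl.
have -> : l.+1%:Z - 1 = l%:Z by rewrite -addn1 PoszD addrK.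
by rewrite -exprnP -!natrX -!natrM ler_nat.
Qed.
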